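(* Let $p\in(0,\pi)$. For $t\in(-\pi/2,\pi/2)$ put $\Omega_p(t)=e^{ip\sin t}\big(\cosh(p\cos t)-i\frac{\sinh(p\cos t)\sin t}{\cos t}\big)$, $\omega_p(t)=\frac{\sinh(p\cos t)}{\cos t}$, and $\Omega_p(\pm\pi/2)=(\cos p+p\sin p)\pm i(\sin p-p\cos p)$, $\omega_p(\pm\pi/2)=p$; let $\gamma_p(t)=e^{p\cos t+ip\sin t}$. Then: (a) For $t\in[-\pi/2,\pi/2]$ the circle $\partial\overline D(\Omega_p(t),\omega_p(t))$ is tangent to the curve $\partial\exp\overline D(0,p)$ at $\gamma_p(t)=e^{p\cos t+ip\sin t}$ and at $e^{-p\cos t+ip\sin t}$ (points that are inverse to each other with respect to the unit circle); when these coincide ($t=\pm\pi/2$) the disk is the osculating disk at $\gamma_p(t)$. The disks are orthogonal to the unit circle and pairwise distinct. (b) $\operatorname{CD}(W(p,p\sin t))=\overline D(\Omega_p(t),\omega_p(t))$, where $W(p,w)=\exp(w\tilde I)\exp(-w\tilde I+p\tilde K)$. (c) The disks $\overline D(\Omega_p(t),\omega_p(t))$, $t\in[-\pi/2,\pi/2]$, are exactly the maximal (with respect to inclusion) closed disks contained in $\exp\overline D(0,p)$, and $\overline D(\Omega_p(t),\omega_p(t))$ meets $\partial\exp\overline D(0,p)$ only at $e^{\pm p\cos t+ip\sin t}$.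
   Context: $\exp\overline D(0,p)=\{e^z: z\in\mathbb C,|z|\le p\}\subset\mathbb C$. $\tilde I=\begin{pmatrix}0&-1\\1&0\end{pmatrix}$, $\tilde J=\begin{pmatrix}1&0\\0&-1\end{pmatrix}$, $\tilde K=\begin{pmatrix}0&1\\1&0\end{pmatrix}$. For real $A=\tilde a\mathrm{Id}_2+\tilde b\tilde I+\tilde c\tilde J+\tilde d\tilde K$, the chiral disk is $\operatorname{CD}(A)=\overline D(\tilde a+\tilde b i,\sqrt{\tilde c^2+\tilde d^2})\subset\mathbb C$. *)

(* Defs.v *)
From Stdlib Require Import Reals Factorial.
From Coquelicot Require Import Coquelicot.
Open Scope R_scope.

Definition Cexp (z : C) : C :=
  (exp (fst z) * cos (snd z), exp (fst z) * sin (snd z)).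

Definition set_eq (S T : C -> Prop) : Prop := forall z, S z <-> T z.
Definition subset (S T : C -> Prop) : Prop := forall z, S z -> T z.

Definition Dset (c : C) (r : R) : C -> Prop := fun z => Cmod (Cminus z c) <= r.

Definition expD (p : R) : C -> Prop := fun w => exists z, Cmod z <= p /\ w = Cexp z.

Definition boundary (S : C -> Prop) (z : C) : Prop :=
  forall eps, 0 < eps ->
    (exists w, S w /\ Cmod (Cminus w z) < eps) /\
    (exists w, ~ S w /\ Cmod (Cminus w z) < eps).

(* the curve  \partial exp \overline D(0,p), parametrised as s |-> exp(p e^{is}) *)
Definition Gamma (p s : R) : C := Cexp (p * cos s, p * sin s).

(* the circle \partial D(c,r) is tangent (first-order contact) to the curve G
   at the point q: q = G s0 for some s0, q lies on the circle, and
   s |-> |G s - c|^2 has vanishing derivative at s0. *)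
Definition circle_tangent_at (G : R -> C) (q c : C) (r : R) : Prop :=
  exists s0, G s0 = q /\ Cmod (Cminus q c) = r /\
    is_derive (fun s => (Cmod (Cminus (G s) c)) ^ 2) s0 0.

Definition circle_osculating_at (G : R -> C) (q c : C) (r : R) : Prop :=
  exists s0, G s0 = q /\ Cmod (Cminus q c) = r /\
    is_derive (fun s => (Cmod (Cminus (G s) c)) ^ 2) s0 0 /\
    is_derive (Derive (fun s => (Cmod (Cminus (G s) c)) ^ 2)) s0 0.

Definition orthogonal_to_unit_circle (c : C) (r : R) : Prop :=
  (Cmod c) ^ 2 = 1 + r ^ 2.

Definition maximal_disk_in (S : C -> Prop) (c : C) (r : R) : Prop :=
  subset (Dset c r) S /\
  forall c' r', 0 <= r' -> subset (Dset c r) (Dset c' r') ->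
    subset (Dset c' r') S -> set_eq (Dset c' r') (Dset c r).

Definition Omega (p t : R) : C :=
  if Req_EM_T t (PI / 2) then (cos p + p * sin p, sin p - p * cos p)
  else if Req_EM_T t (- (PI / 2)) then (cos p + p * sin p, - (sin p - p * cos p))
  else Cmult (Cexp (0, p * sin t))
             (cosh (p * cos t), - (sinh (p * cos t) * sin t / cos t)).

Definition omega (p t : R) : R :=
  if Req_EM_T t (PI / 2) then p
  else if Req_EM_T t (- (PI / 2)) then p
  else sinh (p * cos t) / cos t.

Record M2 := mkM2 { m11 : R; m12 : R; m21 : R; m22 : R }.

Definition madd (A B : M2) : M2 :=
  mkM2 (m11 A + m11 B) (m12 A + m12 B) (m21 A + m21 B) (m22 A + m22 B).
Definition mscale (a : R) (A : M2) : M2 :=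
  mkM2 (a * m11 A) (a * m12 A) (a * m21 A) (a * m22 A).
Definition mmul (A B : M2) : M2 :=
  mkM2 (m11 A * m11 B + m12 A * m21 B) (m11 A * m12 B + m12 A * m22 B)
       (m21 A * m11 B + m22 A * m21 B) (m21 A * m12 B + m22 A * m22 B).
Definition mid : M2 := mkM2 1 0 0 1.
Fixpoint mpow (A : M2) (n : nat) : M2 :=
  match n with O => mid | S k => mmul A (mpow A k) end.

Definition mexp (A : M2) : M2 :=
  mkM2 (Series (fun n => m11 (mpow A n) / INR (fact n)))
       (Series (fun n => m12 (mpow A n) / INR (fact n)))
       (Series (fun n => m21 (mpow A n) / INR (fact n)))
       (Series (fun n => m22 (mpow A n) / INR (fact n))).

Definition It : M2 := mkM2 0 (-1) 1 0.
Definition Jt : M2 := mkM2 1 0 0 (-1).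
Definition Kt : M2 := mkM2 0 1 1 0.

(* coefficients of A = a Id + b I + c J + d K (unique decomposition) *)
Definition ca (A : M2) : R := (m11 A + m22 A) / 2.
Definition cb (A : M2) : R := (m21 A - m12 A) / 2.
Definition cc (A : M2) : R := (m11 A - m22 A) / 2.
Definition cd (A : M2) : R := (m12 A + m21 A) / 2.

Definition CD (A : M2) : C -> Prop := Dset (ca A, cb A) (sqrt (cc A ^ 2 + cd A ^ 2)).

Definition W (p w : R) : M2 :=
  mmul (mexp (mscale w It)) (mexp (madd (mscale (- w) It) (mscale p Kt))).

Lemma decomp_check (A : M2) :
  A = madd (madd (mscale (ca A) mid) (mscale (cb A) It))
           (madd (mscale (cc A) Jt) (mscale (cd A) Kt)).
Proof.
  destruct A as [a b c d]; unfold madd, mscale, mid, It, Jt, Kt, ca, cb, cc, cd; simpl.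
  f_equal; field.
Qed.

(* Main.v *)
(** Put [w = p sin t]. In logarithmic coordinates [z = exp (x + iy)] the set [exp D(0,p)] is
    [cosh x <= g y] with [g y = cosh (sqrt (p^2 - y^2))], and the disk of index [t], being
    orthogonal to the unit circle, is [cosh x <= h y] where [h] is the sinusoid
    ([h'' + h = 0]) tangent to [g] at [y = w]. Since [g'' + g > 0], Sturm comparison gives [h < g]
    away from [w]: the disk lies in the set and meets its boundary only over [y = w].
    For maximality, given a disk [D(c,r)] in the set, choose [w] maximizing
    [radius - |c - centre|]; criticality says that the point of that circle nearest to [c] is a
    contact point, hence on the boundary of the set, which forces [D(c,r)] into the disk of
    index [w]. *)
Require Import Defs.
From Stdlib Require Import Reals Lra Lia Psatz Factorial.
From Coquelicot Require Import Coquelicot.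
Open Scope R_scope.

(** * Entire functions replacing cosh and sinh of a square root *)

(* [cosh (sqrt u)] and [sinh (sqrt u) / sqrt u], as entire functions of [u]; for [u < 0] they are
   [cos (sqrt (- u))] and [sin (sqrt (- u)) / sqrt (- u)]. *)
Definition cosh_sqrt (u : R) : R := PSeries (fun n => / INR (fact (2 * n))) u.
Definition sinhc_sqrt (u : R) : R := PSeries (fun n => / INR (fact (2 * n + 1))) u.
Definition sinhc_sqrt' (u : R) : R :=
  PSeries (PS_derive (fun n => / INR (fact (2 * n + 1)))) u.

(** The ratio of consecutive coefficients is at most 1/(n+1), so the ratio test gives infinite
    radius. The index map [f] covers the even and the odd factorials at once. *)
Lemma CV_radius_inv_fact (f : nat -> nat) :
  (forall n, f n + 1 <= f (S n))%nat -> (forall n, n <= f n)%nat ->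
  CV_radius (fun n => / INR (fact (f n))) = p_infty.
Proof.
  intros Hf Hn. apply CV_radius_infinite_DAlembert.
  { intros n. apply Rinv_neq_0_compat, INR_fact_neq_0. }
  apply is_lim_seq_le_le with (u := fun _ => 0) (w := fun n => / INR (S n)).
  - intros n. split; [apply Rabs_pos|].
    pose proof (INR_fact_lt_0 (f n)) as H1.
    pose proof (INR_fact_lt_0 (f (S n))) as H2.
    assert (H3 : INR (S n) * INR (fact (f n)) <= INR (fact (f (S n)))).
    { rewrite <- mult_INR. apply le_INR.
      apply Nat.le_trans with (fact (S (f n))).
      - change (fact (S (f n))) with (S (f n) * fact (f n))%nat.
        apply Nat.mul_le_mono_r. specialize (Hn n). lia.
      - apply fact_le. specialize (Hf n). lia. }
    assert (H0 : 0 < INR (S n)) by (apply lt_0_INR; lia).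
    rewrite Rabs_pos_eq.
    + unfold Rdiv. rewrite Rinv_inv.
      apply Rmult_le_reg_l with (INR (S n)); [easy|].
      rewrite Rinv_r by lra.
      apply Rmult_le_reg_r with (INR (fact (f (S n)))); [easy|].
      replace (INR (S n) * (/ INR (fact (f (S n))) * INR (fact (f n))) *
               INR (fact (f (S n)))) with (INR (S n) * INR (fact (f n)))
        by (field; lra).
      lra.
    + apply Rlt_le, Rdiv_lt_0_compat; now apply Rinv_0_lt_compat.
  - apply is_lim_seq_const.
  - apply (is_lim_seq_incr_1 (fun n => / INR n)).
    apply is_lim_seq_inv with (l := p_infty); [apply is_lim_seq_INR | easy].
Qed.

Lemma CV_cosh_sqrt : CV_radius (fun n => / INR (fact (2 * n))) = p_infty.
Proof. apply (CV_radius_inv_fact (fun n => 2 * n)%nat); intros; lia. Qed.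

Lemma CV_sinhc_sqrt : CV_radius (fun n => / INR (fact (2 * n + 1))) = p_infty.
Proof. apply (CV_radius_inv_fact (fun n => 2 * n + 1)%nat); intros; lia. Qed.

Lemma ex_cosh_sqrt u : ex_pseries (fun n => / INR (fact (2 * n))) u.
Proof. apply CV_radius_inside. now rewrite CV_cosh_sqrt. Qed.

Lemma ex_sinhc_sqrt u : ex_pseries (fun n => / INR (fact (2 * n + 1))) u.
Proof. apply CV_radius_inside. now rewrite CV_sinhc_sqrt. Qed.

Lemma is_derive_cosh_sqrt u : is_derive cosh_sqrt u (sinhc_sqrt u / 2).
Proof.
  replace (sinhc_sqrt u / 2)
    with (PSeries (PS_derive (fun n => / INR (fact (2 * n)))) u).
  { apply is_derive_PSeries. now rewrite CV_cosh_sqrt. }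
  unfold sinhc_sqrt, Rdiv. rewrite Rmult_comm, <- PSeries_scal.
  apply PSeries_ext. intros n. unfold PS_derive, PS_scal.
  change (scal (/ 2) (/ INR (fact (2 * n + 1)))) with (/ 2 * / INR (fact (2 * n + 1))).
  replace (2 * S n)%nat with (S (2 * n + 1)) by lia.
  change (fact (S (2 * n + 1))) with (S (2 * n + 1) * fact (2 * n + 1))%nat.
  rewrite mult_INR. pose proof (INR_fact_lt_0 (2 * n + 1)).
  replace (INR (S (2 * n + 1))) with (2 * INR (S n))
    by (replace (S (2 * n + 1)) with (2 * S n)%nat by lia; rewrite mult_INR; simpl; lra).
  assert (0 < INR (S n)) by (apply lt_0_INR; lia).
  field. split; lra.
Qed.

Lemma is_derive_sinhc_sqrt u : is_derive sinhc_sqrt u (sinhc_sqrt' u).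
Proof. apply is_derive_PSeries. now rewrite CV_sinhc_sqrt. Qed.

Lemma ex_derive_cosh_sqrt u : ex_derive (fun x => cosh_sqrt x) u.
Proof. eexists. apply is_derive_cosh_sqrt. Qed.

Lemma ex_derive_sinhc_sqrt u : ex_derive (fun x => sinhc_sqrt x) u.
Proof. eexists. apply is_derive_sinhc_sqrt. Qed.

Lemma Derive_cosh_sqrt u : Derive (fun x => cosh_sqrt x) u = sinhc_sqrt u / 2.
Proof. apply is_derive_unique, is_derive_cosh_sqrt. Qed.

Lemma Derive_sinhc_sqrt u : Derive (fun x => sinhc_sqrt x) u = sinhc_sqrt' u.
Proof. apply is_derive_unique, is_derive_sinhc_sqrt. Qed.

(** For [u = x^2] this is the derivative of [x * sinhc_sqrt (x^2) = sinh x]; comparing coefficients,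
    1/(2n)! = (2n+1)/(2n+1)!, proves it for every real [u]. It makes the derivatives of [centre]
    collapse to multiples of [sinhc_sqrt']. *)
Lemma cosh_sqrt_eq u : cosh_sqrt u = sinhc_sqrt u + 2 * u * sinhc_sqrt' u.
Proof.
  unfold cosh_sqrt, sinhc_sqrt, sinhc_sqrt'.
  rewrite Rmult_assoc, <- PSeries_incr_1, <- PSeries_scal, <- PSeries_plus.
  - apply PSeries_ext. intros [|n].
    + unfold PS_plus, PS_scal, PS_incr_1. simpl.
      unfold plus, scal, zero, mult; simpl. unfold mult; simpl. lra.
    + unfold PS_plus, PS_scal, PS_incr_1, PS_derive.
      change (/ INR (fact (2 * S n)) =
        / INR (fact (2 * S n + 1)) + 2 * (INR (S n) * / INR (fact (2 * S n + 1)))).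
      replace (2 * S n + 1)%nat with (S (2 * S n)) by lia.
      change (fact (S (2 * S n))) with (S (2 * S n) * fact (2 * S n))%nat.
      rewrite mult_INR, S_INR, (mult_INR 2 (S n)).
      pose proof (INR_fact_lt_0 (2 * S n)).
      assert (0 < INR (S n)) by (apply lt_0_INR; lia).
      change (INR 2) with 2. field. split; lra.
  - apply ex_sinhc_sqrt.
  - apply CV_radius_inside.
    rewrite CV_radius_scal by lra.
    rewrite CV_radius_incr_1, CV_radius_derive. now rewrite CV_sinhc_sqrt.
Qed.

Lemma exp_cosh_sqrt x : exp x = cosh_sqrt (x ^ 2) + x * sinhc_sqrt (x ^ 2).
Proof.
  rewrite exp_Reals. apply PSeries_odd_even; [apply ex_cosh_sqrt | apply ex_sinhc_sqrt].
Qed.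

Lemma cosh_sqrt_sqr x : cosh_sqrt (x ^ 2) = cosh x.
Proof.
  unfold cosh. rewrite (exp_cosh_sqrt x), (exp_cosh_sqrt (- x)).
  replace ((- x) ^ 2) with (x ^ 2) by ring. field.
Qed.

Lemma sinhc_sqrt_sqr x : x * sinhc_sqrt (x ^ 2) = sinh x.
Proof.
  unfold sinh. rewrite (exp_cosh_sqrt x), (exp_cosh_sqrt (- x)).
  replace ((- x) ^ 2) with (x ^ 2) by ring. field.
Qed.

Lemma cosh_sqrt_0 : cosh_sqrt 0 = 1.
Proof. unfold cosh_sqrt. rewrite PSeries_0. simpl. lra. Qed.

Lemma sinhc_sqrt_0 : sinhc_sqrt 0 = 1.
Proof. unfold sinhc_sqrt. rewrite PSeries_0. simpl. lra. Qed.

(* Both pairs solve f' = -g, g' = f with the same initial values. *)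
Lemma cos_sin_cosh_sqrt x :
  cosh_sqrt (- x ^ 2) = cos x /\ x * sinhc_sqrt (- x ^ 2) = sin x.
Proof.
  set (E := fun x => (cosh_sqrt (- x ^ 2) - cos x) ^ 2 +
                     (x * sinhc_sqrt (- x ^ 2) - sin x) ^ 2).
  assert (HE : forall y, is_derive E y 0).
  { intros y. unfold E.
    auto_derive.
    - repeat split; (apply ex_derive_cosh_sqrt || apply ex_derive_sinhc_sqrt).
    - rewrite Derive_cosh_sqrt, Derive_sinhc_sqrt, cosh_sqrt_eq. field. }
  assert (H0 : E 0 = 0).
  { unfold E. replace (- 0 ^ 2) with 0 by ring.
    rewrite cosh_sqrt_0, cos_0, sin_0. ring. }
  assert (Hx : E x = 0).
  { destruct (MVT_gen E 0 x (fun _ => 0)) as [c [_ Hc]].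
    - intros y _. apply HE.
    - intros y _. apply continuity_pt_filterlim.
      apply (ex_derive_continuous E y). eexists; apply HE.
    - lra. }
  unfold E in Hx.
  pose proof (pow2_ge_0 (cosh_sqrt (- x ^ 2) - cos x)).
  pose proof (pow2_ge_0 (x * sinhc_sqrt (- x ^ 2) - sin x)).
  split; apply Rminus_diag_uniq, Rsqr_0_uniq; unfold Rsqr; simpl in *; lra.
Qed.

Lemma sqr_sign_cases u : (exists x, 0 <= x /\ u = x ^ 2) \/ (exists x, 0 < x /\ u = - x ^ 2).
Proof.
  destruct (Rle_lt_dec 0 u) as [H|H].
  - left. exists (sqrt u). split; [apply sqrt_pos | now rewrite pow2_sqrt].
  - right. exists (sqrt (- u)). split; [apply sqrt_lt_R0; lra | rewrite pow2_sqrt; lra].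
Qed.

(** Unites cosh^2 - sinh^2 = 1 and cos^2 + sin^2 = 1; it is the source of orthogonality to the unit
    circle. *)
Lemma cosh_sqrt_sqr_sub u : cosh_sqrt u ^ 2 - u * sinhc_sqrt u ^ 2 = 1.
Proof.
  destruct (sqr_sign_cases u) as [[x [_ ->]]|[x [_ ->]]].
  - replace (x ^ 2 * sinhc_sqrt (x ^ 2) ^ 2) with ((x * sinhc_sqrt (x ^ 2)) ^ 2) by ring.
    rewrite sinhc_sqrt_sqr, cosh_sqrt_sqr. unfold cosh, sinh.
    assert (exp x * exp (- x) = 1) by (rewrite <- exp_plus, Rplus_opp_r; apply exp_0).
    nra.
  - replace (- x ^ 2 * sinhc_sqrt (- x ^ 2) ^ 2)
      with (- (x * sinhc_sqrt (- x ^ 2)) ^ 2) by ring.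
    destruct (cos_sin_cosh_sqrt x) as [-> ->].
    pose proof (sin2_cos2 x). unfold Rsqr in *. lra.
Qed.

Lemma sinhc_sqrt_pos u : 0 <= u -> 0 < sinhc_sqrt u.
Proof.
  intros Hu. destruct (Rle_lt_or_eq_dec _ _ Hu) as [H|<-].
  - assert (Hs := sqrt_lt_R0 _ H).
    assert (Hx := sinhc_sqrt_sqr (sqrt u)). rewrite pow2_sqrt in Hx by easy.
    assert (0 < sinh (sqrt u)).
    { unfold sinh. assert (exp (- sqrt u) < exp (sqrt u)) by (apply exp_increasing; lra). lra. }
    nra.
  - rewrite sinhc_sqrt_0. lra.
Qed.

Lemma cosh_sqrt_increasing u v : 0 <= u -> u < v -> cosh_sqrt u < cosh_sqrt v.
Proof.
  intros Hu Huv.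
  destruct (MVT_cor2 cosh_sqrt (fun x => sinhc_sqrt x / 2) u v Huv) as [c [Hc1 Hc2]].
  - intros c _. apply is_derive_Reals, is_derive_cosh_sqrt.
  - pose proof (sinhc_sqrt_pos c). nra.
Qed.

Lemma cosh_sqrt_ge_1 u : 0 <= u -> 1 <= cosh_sqrt u.
Proof.
  intros Hu. rewrite <- cosh_sqrt_0. destruct (Rle_lt_or_eq_dec _ _ Hu) as [H|<-]; [|lra].
  apply Rlt_le, cosh_sqrt_increasing; lra.
Qed.

Lemma cosh_sqrt_le_1 u : u <= 0 -> cosh_sqrt u <= 1.
Proof.
  intros Hu. destruct (sqr_sign_cases u) as [[x [_ ->]]|[x [_ ->]]].
  - assert (x = 0) by nra. subst. replace (0 ^ 2) with 0 by ring. rewrite cosh_sqrt_0. lra.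
  - destruct (cos_sin_cosh_sqrt x) as [-> _]. apply COS_bound.
Qed.

(** By [cosh_sqrt_eq], [2 * x^3 * sinhc_sqrt' u] is x cosh x - sinh x when [u = x^2], and sin x - x
    cos x when [u = - x^2]. Both vanish at 0 and have derivatives x sinh x and x sin x; the latter
    is positive on (0, PI), whence the bound on [u]. At [u = 0] the value is a coefficient of the
    series. *)
Lemma sinhc_sqrt'_pos u : - PI ^ 2 < u -> 0 < sinhc_sqrt' u.
Proof.
  intros Hu. pose proof (cosh_sqrt_eq u) as He.
  destruct (sqr_sign_cases u) as [[x [Hx ->]]|[x [Hx ->]]].
  - destruct (Rle_lt_or_eq_dec _ _ Hx) as [Hx0|<-].
    + assert (Hlt : sinh x < x * cosh x).
      { destruct (MVT_cor2 (fun x => x * cosh x - sinh x) (fun x => x * sinh x) 0 x Hx0)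
          as [c [Hc1 Hc2]].
        - intros c _. apply is_derive_Reals. unfold cosh, sinh. auto_derive; [easy|field].
        - rewrite sinh_0 in Hc1. pose proof (sinhc_sqrt_sqr c).
          pose proof (sinhc_sqrt_pos (c ^ 2) (pow2_ge_0 c)).
          assert (0 < sinh c) by nra. assert (0 < c * sinh c) by nra. nra. }
      rewrite <- cosh_sqrt_sqr, <- sinhc_sqrt_sqr, He in Hlt.
      assert (0 < x ^ 3) by (apply pow_lt; lra). nra.
    + unfold sinhc_sqrt'. replace (0 ^ 2) with 0 by ring. rewrite PSeries_0.
      unfold PS_derive. apply Rmult_lt_0_compat; [apply lt_0_INR; lia|].
      apply Rinv_0_lt_compat, INR_fact_lt_0.
  - pose proof PI_RGT_0.
    assert (HxP : x < PI) by nra.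
    assert (Hlt : x * cos x < sin x).
    { destruct (MVT_cor2 (fun x => sin x - x * cos x) (fun x => x * sin x) 0 x Hx)
        as [c [Hc1 Hc2]].
      - intros c _. apply is_derive_Reals. auto_derive; [easy|ring].
      - rewrite sin_0 in Hc1.
        assert (0 < sin c) by (apply sin_gt_0; lra). assert (0 < c * sin c) by nra. nra. }
    destruct (cos_sin_cosh_sqrt x) as [Hc Hs].
    rewrite <- Hc, <- Hs, He in Hlt.
    assert (0 < x ^ 3) by (apply pow_lt; lra). nra.
Qed.

(** * Exponentials of matrices whose square is scalar *)

Lemma Series_exp_even_odd (e : nat -> R) (u a b : R) :
  (forall n, e (2 * n)%nat = u ^ n * a) -> (forall n, e (2 * n + 1)%nat = u ^ n * b) ->
  Series (fun n => e n / INR (fact n)) = cosh_sqrt u * a + sinhc_sqrt u * b.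
Proof.
  intros He Ho.
  (* The argument [1 ^ 2] is the shape in which [PSeries_odd_even] leaves a series evaluated at
     1. *)
  assert (aux : forall (f : nat -> nat) (x : R), (forall n, e (f n) = u ^ n * x) ->
    ex_pseries (fun n => / INR (fact (f n))) u ->
    ex_pseries (fun n => e (f n) / INR (fact (f n))) (1 ^ 2) /\
    PSeries (fun n => e (f n) / INR (fact (f n))) (1 ^ 2) =
      PSeries (fun n => / INR (fact (f n))) u * x).
  { intros f x Hf Hex.
    assert (Heq : forall n, / INR (fact (f n)) * u ^ n * x =
                            e (f n) / INR (fact (f n)) * (1 ^ 2) ^ n).
    { intros n. rewrite Hf. replace (1 ^ 2) with 1 by ring. rewrite pow1.
      field. apply INR_fact_neq_0. }
    apply ex_pseries_R in Hex. split.
    - apply ex_pseries_R, ex_series_ext with (1 := Heq).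
      now apply ex_series_scal_r.
    - unfold PSeries. rewrite <- Series_scal_r. symmetry. now apply Series_ext. }
  destruct (aux (fun n => 2 * n)%nat a He (ex_cosh_sqrt u)) as [He1 He2].
  destruct (aux (fun n => 2 * n + 1)%nat b Ho (ex_sinhc_sqrt u)) as [Ho1 Ho2].
  transitivity (PSeries (fun n => e n / INR (fact n)) 1).
  { apply Series_ext. intros n. rewrite pow1. ring. }
  rewrite PSeries_odd_even, He2, Ho2 by assumption. unfold cosh_sqrt, sinhc_sqrt. ring.
Qed.

Lemma mpow_sqr_scalar (N : M2) (u : R) : mmul N N = mscale u mid ->
  forall n, mpow N (2 * n) = mscale (u ^ n) mid /\ mpow N (2 * n + 1) = mscale (u ^ n) N.
Proof.
  intros HN. assert (H0 : forall n, mpow N (2 * n) = mscale (u ^ n) mid).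
  { induction n as [|n IH].
    - unfold mscale, mid. simpl. unfold mid. f_equal; ring.
    - replace (2 * S n)%nat with (S (S (2 * n))) by lia.
      simpl mpow. simpl in IH. rewrite IH.
      destruct N as [a b c d]. unfold mmul, mscale, mid in *. simpl in *.
      injection HN as H1 H2 H3 H4. f_equal.
      + transitivity (u ^ n * (u * 1)); [rewrite <- H1|]; ring.
      + transitivity (u ^ n * (u * 0)); [rewrite <- H2|]; ring.
      + transitivity (u ^ n * (u * 0)); [rewrite <- H3|]; ring.
      + transitivity (u ^ n * (u * 1)); [rewrite <- H4|]; ring. }
  intros n. split; [apply H0|].
  replace (2 * n + 1)%nat with (S (2 * n)) by lia.
  change (mpow N (S (2 * n))) with (mmul N (mpow N (2 * n))). rewrite H0.
  destruct N. unfold mmul, mscale, mid. simpl. f_equal; ring.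
Qed.

(** Even powers of [N] are scalar and odd powers are multiples of [N]. Both exponents in [W] have
    this form, with [u = - w^2] and [u = p^2 - w^2]. *)
Lemma mexp_sqr_scalar (N : M2) (u : R) : mmul N N = mscale u mid ->
  mexp N = madd (mscale (cosh_sqrt u) mid) (mscale (sinhc_sqrt u) N).
Proof.
  intros HN. pose proof (mpow_sqr_scalar N u HN) as Hp.
  unfold mexp, madd. f_equal;
    (apply Series_exp_even_odd; intros n; destruct (Hp n) as [Hp1 Hp2];
     rewrite ?Hp1, ?Hp2; reflexivity).
Qed.

(** * Centres, radii and chiral disks *)

(* Center and radius of the disk as functions of [w = p sin t]; here
   [Omega = e^{iw} (cosh_sqrt u - i w sinhc_sqrt u)] with [u = p^2 - w^2 = (p cos t)^2],
   which has no singularity at [t = +-PI/2]. *)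
Definition centre (p w : R) : C :=
  (cos w * cosh_sqrt (p ^ 2 - w ^ 2) + sin w * (w * sinhc_sqrt (p ^ 2 - w ^ 2)),
   sin w * cosh_sqrt (p ^ 2 - w ^ 2) - cos w * (w * sinhc_sqrt (p ^ 2 - w ^ 2))).

Definition radius (p w : R) : R := p * sinhc_sqrt (p ^ 2 - w ^ 2).

Lemma sub_sqr_sin p t : p ^ 2 - (p * sin t) ^ 2 = (p * cos t) ^ 2.
Proof. pose proof (sin2_cos2 t). unfold Rsqr in *. nra. Qed.

Lemma Omega_centre p t : - (PI / 2) <= t <= PI / 2 -> Omega p t = centre p (p * sin t).
Proof.
  intros Ht. unfold Omega, centre. rewrite sub_sqr_sin.
  destruct (Req_EM_T t (PI / 2)) as [->|H1].
  { rewrite cos_PI2, sin_PI2. replace ((p * 0) ^ 2) with 0 by ring.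
    rewrite cosh_sqrt_0, sinhc_sqrt_0. replace (p * 1) with p by ring. f_equal; ring. }
  destruct (Req_EM_T t (- (PI / 2))) as [->|H2].
  { rewrite cos_neg, sin_neg, cos_PI2, sin_PI2. replace ((p * 0) ^ 2) with 0 by ring.
    rewrite cosh_sqrt_0, sinhc_sqrt_0. replace (p * - (1)) with (- p) by ring.
    rewrite cos_neg, sin_neg. f_equal; ring. }
  assert (0 < cos t) by (apply cos_gt_0; lra).
  rewrite <- cosh_sqrt_sqr, <- sinhc_sqrt_sqr.
  unfold Cmult, Cexp. cbn [fst snd]. rewrite exp_0. f_equal; field; lra.
Qed.

Lemma omega_radius p t : - (PI / 2) <= t <= PI / 2 -> omega p t = radius p (p * sin t).
Proof.
  intros Ht. unfold omega, radius. rewrite sub_sqr_sin.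
  destruct (Req_EM_T t (PI / 2)) as [->|H1].
  { rewrite cos_PI2. replace ((p * 0) ^ 2) with 0 by ring. rewrite sinhc_sqrt_0. ring. }
  destruct (Req_EM_T t (- (PI / 2))) as [->|H2].
  { rewrite cos_neg, cos_PI2. replace ((p * 0) ^ 2) with 0 by ring. rewrite sinhc_sqrt_0. ring. }
  assert (0 < cos t) by (apply cos_gt_0; lra).
  rewrite <- sinhc_sqrt_sqr. field; lra.
Qed.

Lemma radius_pos p w : 0 < p -> w ^ 2 <= p ^ 2 -> 0 < radius p w.
Proof. intros Hp Hw. apply Rmult_lt_0_compat, sinhc_sqrt_pos; lra. Qed.

(** The first factor of [W] is the rotation by [w]. It multiplies the [mid], [It] part of the second
    factor, read as a complex number, by e^{iw}, which gives [centre]; it rotates the [Jt], [Kt]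
    part, whose length stays [radius]. *)
Lemma CD_W p w : 0 < p -> w ^ 2 <= p ^ 2 ->
  set_eq (CD (W p w)) (Dset (centre p w) (radius p w)).
Proof.
  intros Hp Hw.
  assert (HW : W p w = mmul (madd (mscale (cos w) mid) (mscale (sin w) It))
    (madd (mscale (cosh_sqrt (p ^ 2 - w ^ 2)) mid)
          (mscale (sinhc_sqrt (p ^ 2 - w ^ 2)) (madd (mscale (- w) It) (mscale p Kt))))).
  { unfold W. rewrite (mexp_sqr_scalar (mscale w It) (- w ^ 2)).
    2:{ unfold mmul, mscale, mid, It. simpl. f_equal; ring. }
    rewrite (mexp_sqr_scalar (madd (mscale (- w) It) (mscale p Kt)) (p ^ 2 - w ^ 2)).
    2:{ unfold mmul, madd, mscale, mid, It, Kt. simpl. f_equal; ring. }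
    destruct (cos_sin_cosh_sqrt w) as [<- <-]. f_equal.
    unfold madd, mscale, It, mid. simpl. f_equal; ring. }
  unfold CD. rewrite HW.
  set (c := cosh_sqrt (p ^ 2 - w ^ 2)). set (s := sinhc_sqrt (p ^ 2 - w ^ 2)).
  match goal with |- set_eq (Dset ?x ?r) _ =>
    replace x with (centre p w); [replace r with (radius p w)|] end.
  - intros z. tauto.
  - rewrite <- (sqrt_pow2 (radius p w)) by (apply Rlt_le, radius_pos; assumption).
    f_equal. unfold radius. fold s.
    unfold cc, cd, mmul, madd, mscale, It, Kt, mid. simpl.
    replace ((p * s) * ((p * s) * 1)) with ((p * s) ^ 2 * (Rsqr (sin w) + Rsqr (cos w)))
      by (rewrite sin2_cos2; ring).
    unfold Rsqr. field.
  - unfold centre. fold c s.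
    unfold ca, cb, mmul, madd, mscale, It, Kt, mid. simpl. f_equal; field.
Qed.

(** * Disks in logarithmic coordinates and Sturm comparison *)

(* In the coordinates [z = exp (x + iy)] the disk is [cosh x <= disk_profile p w y]. *)
Definition disk_profile (p w y : R) : R :=
  cosh_sqrt (p ^ 2 - w ^ 2) * cos (y - w) - w * sinhc_sqrt (p ^ 2 - w ^ 2) * sin (y - w).

Lemma Cmod_sqr (z : C) : Cmod z ^ 2 = fst z ^ 2 + snd z ^ 2.
Proof. unfold Cmod. rewrite pow2_sqrt; [easy|]. nra. Qed.

Lemma centre_orthogonal p w : Cmod (centre p w) ^ 2 = 1 + radius p w ^ 2.
Proof.
  rewrite Cmod_sqr. unfold centre, radius. cbn [fst snd].
  pose proof (cosh_sqrt_sqr_sub (p ^ 2 - w ^ 2)) as H.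
  set (c := cosh_sqrt (p ^ 2 - w ^ 2)) in *. set (s := sinhc_sqrt (p ^ 2 - w ^ 2)) in *.
  transitivity ((Rsqr (sin w) + Rsqr (cos w)) * (c ^ 2 + w ^ 2 * s ^ 2)).
  - unfold Rsqr. ring.
  - rewrite sin2_cos2. lra.
Qed.

(** Law of cosines: [exp x * disk_profile p w y] is the inner product of the point with the centre,
    and orthogonality replaces the squared norm of the centre by [1 + radius p w ^ 2]. *)
Lemma dist_centre p w x y :
  Cmod (Cminus (Cexp (x, y)) (centre p w)) ^ 2 =
  exp x ^ 2 + 1 - 2 * exp x * disk_profile p w y + radius p w ^ 2.
Proof.
  assert (H : forall z c : C, Cmod (Cminus z c) ^ 2 =
    Cmod z ^ 2 - 2 * (fst z * fst c + snd z * snd c) + Cmod c ^ 2).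
  { intros z c. rewrite !Cmod_sqr. simpl. ring. }
  rewrite H, centre_orthogonal, Cmod_sqr. unfold Cexp, centre, disk_profile. cbn [fst snd].
  rewrite cos_minus, sin_minus.
  replace ((exp x * cos y) ^ 2 + (exp x * sin y) ^ 2)
    with (exp x ^ 2 * (Rsqr (sin y) + Rsqr (cos y))) by (unfold Rsqr; ring).
  rewrite sin2_cos2. ring.
Qed.

Lemma exp_sqr_cosh x : exp x ^ 2 + 1 = 2 * exp x * cosh x.
Proof.
  unfold cosh. assert (exp x * exp (- x) = 1) by (rewrite <- exp_plus, Rplus_opp_r; apply exp_0).
  nra.
Qed.

Lemma Dset_centre p w x y : 0 < p -> w ^ 2 <= p ^ 2 ->
  Dset (centre p w) (radius p w) (Cexp (x, y)) <-> cosh x <= disk_profile p w y.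
Proof.
  intros Hp Hw. pose proof (dist_centre p w x y) as H. rewrite exp_sqr_cosh in H.
  pose proof (radius_pos p w Hp Hw). pose proof (exp_pos x). unfold Dset.
  pose proof (Cmod_ge_0 (Cminus (Cexp (x, y)) (centre p w))) as HC.
  set (d := Cmod _) in *. split; intros H2; nra.
Qed.

Lemma disk_profile_diag p w : disk_profile p w w = cosh_sqrt (p ^ 2 - w ^ 2).
Proof. unfold disk_profile. rewrite Rminus_diag, cos_0, sin_0. ring. Qed.

(* [g y = cosh_sqrt (p^2 - y^2)] satisfies [g'' + g = 2 p^2 sinhc_sqrt' (p^2 - y^2) > 0] and
   [disk_profile p w] is the solution of [h'' + h = 0] tangent to [g] at [w]. Hence
   [g x cos (y - x) + g' x sin (y - x)], whose derivative is [(g'' + g) x sin (y - x)], runs from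
   [disk_profile p w y] at [x = w] to [g y] at [x = y]. *)
Lemma disk_profile_lt p w y : 0 < p < PI -> - p <= w <= p -> - PI <= y <= PI ->
  Rabs (y - w) <= PI -> y <> w -> disk_profile p w y < cosh_sqrt (p ^ 2 - y ^ 2).
Proof.
  intros Hp Hw Hy Hyw Hne.
  set (E := fun x => cosh_sqrt (p ^ 2 - x ^ 2) * cos (y - x)
                     - x * sinhc_sqrt (p ^ 2 - x ^ 2) * sin (y - x)).
  set (E' := fun x => 2 * p ^ 2 * sinhc_sqrt' (p ^ 2 - x ^ 2) * sin (y - x)).
  assert (HE : forall x, derivable_pt_lim E x (E' x)).
  { intros x. apply is_derive_Reals. unfold E, E'. auto_derive.
    - repeat split; (apply ex_derive_cosh_sqrt || apply ex_derive_sinhc_sqrt).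
    - rewrite Derive_cosh_sqrt, Derive_sinhc_sqrt, cosh_sqrt_eq.
      replace (p ^ 2 - x ^ 2) with (p * (p * 1) + - (x * (x * 1))) by ring.
      unfold Rminus. field. }
  assert (HEw : E w = disk_profile p w y) by reflexivity.
  assert (HEy : E y = cosh_sqrt (p ^ 2 - y ^ 2)).
  { unfold E. rewrite Rminus_diag, cos_0, sin_0. ring. }
  rewrite <- HEw, <- HEy.
  (* The mean value point lies strictly between [w] and [y], hence in (-PI, PI), where
     [p^2 - x^2 > - PI^2]. *)
  assert (Hk : forall x, - PI < x < PI -> 0 < 2 * p ^ 2 * sinhc_sqrt' (p ^ 2 - x ^ 2)).
  { intros x Hx. assert (0 < sinhc_sqrt' (p ^ 2 - x ^ 2)) by (apply sinhc_sqrt'_pos; nra).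
    assert (0 < p ^ 2) by nra. nra. }
  unfold Rabs in Hyw. destruct (Rcase_abs _).
  - destruct (MVT_cor2 E E' y w ltac:(lra)) as [x [Hx1 Hx2]]; [intros; apply HE|].
    specialize (Hk x ltac:(lra)).
    assert (0 < sin (x - y)) by (apply sin_gt_0; lra).
    assert (Hs : sin (y - x) = - sin (x - y)) by (rewrite <- sin_neg; f_equal; ring).
    unfold E' in Hx1. rewrite Hs in Hx1.
    assert (0 < (2 * p ^ 2 * sinhc_sqrt' (p ^ 2 - x ^ 2)) * sin (x - y)) by nra. nra.
  - destruct (MVT_cor2 E E' w y ltac:(lra)) as [x [Hx1 Hx2]]; [intros; apply HE|].
    specialize (Hk x ltac:(lra)).
    assert (0 < sin (y - x)) by (apply sin_gt_0; lra).
    unfold E' in Hx1.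
    assert (0 < (2 * p ^ 2 * sinhc_sqrt' (p ^ 2 - x ^ 2)) * sin (y - x)) by nra. nra.
Qed.

(** * Choice of the argument and inclusion of the disks *)

Lemma polar_unit a b : a ^ 2 + b ^ 2 = 1 -> exists th, - PI <= th <= PI /\ a = cos th /\ b = sin th.
Proof.
  intros H. assert (Ha : -1 <= a <= 1) by nra.
  pose proof (acos_bound a) as Hb.
  assert (Hs : sin (acos a) = Rabs b).
  { rewrite sin_acos by easy. rewrite <- sqrt_Rsqr_abs. f_equal. unfold Rsqr. lra. }
  unfold Rabs in Hs. destruct (Rcase_abs b).
  - exists (- acos a). rewrite cos_neg, sin_neg, cos_acos by easy. lra.
  - exists (acos a). rewrite cos_acos by easy. lra.
Qed.

(** The branch of the argument is centred at [w], obtained from the argument of z e^{-iw}, because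
    the comparison needs [y] within PI of [w]. *)
Lemma Cexp_surj (z : C) (w : R) : z <> 0%C ->
  exists x y, z = Cexp (x, y) /\ Rabs (y - w) <= PI.
Proof.
  intros Hz. apply Cmod_gt_0 in Hz.
  destruct z as [a b]. pose proof (Cmod_sqr (a, b)) as Hm. set (m := Cmod (a, b)) in *.
  cbn [fst snd] in Hm.
  destruct (polar_unit ((a * cos w + b * sin w) / m) ((b * cos w - a * sin w) / m))
    as [th [Hth [H1 H2]]].
  { transitivity ((a ^ 2 + b ^ 2) * (Rsqr (sin w) + Rsqr (cos w)) / m ^ 2).
    - unfold Rsqr. field. lra.
    - rewrite sin2_cos2, <- Hm. field. lra. }
  exists (ln m), (th + w). split.
  - unfold Cexp. cbn [fst snd]. rewrite exp_ln, cos_plus, sin_plus, <- H1, <- H2 by easy.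
    f_equal.
    + transitivity (a * (Rsqr (sin w) + Rsqr (cos w))); [rewrite sin2_cos2; ring|].
      unfold Rsqr. field. lra.
    + transitivity (b * (Rsqr (sin w) + Rsqr (cos w))); [rewrite sin2_cos2; ring|].
      unfold Rsqr. field. lra.
  - apply Rabs_le. lra.
Qed.

Lemma cosh_ge_1 x : 1 <= cosh x.
Proof. rewrite <- cosh_sqrt_sqr. apply cosh_sqrt_ge_1, pow2_ge_0. Qed.

Lemma cosh_le_cosh_sqrt x u : cosh x <= cosh_sqrt u -> 0 <= u -> x ^ 2 <= u.
Proof.
  rewrite <- cosh_sqrt_sqr. intros H Hu. apply Rnot_lt_le. intros H2.
  pose proof (cosh_sqrt_increasing u (x ^ 2) Hu H2). lra.
Qed.

Lemma cosh_lt_cosh_sqrt x u : cosh x < cosh_sqrt u -> x ^ 2 < u.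
Proof.
  intros H. destruct (Rle_lt_dec u 0) as [Hu|Hu].
  - pose proof (cosh_sqrt_le_1 u Hu). pose proof (cosh_ge_1 x). lra.
  - destruct (cosh_le_cosh_sqrt x u ltac:(lra) ltac:(lra)) as [|He]; [easy|].
    rewrite <- He, cosh_sqrt_sqr in H. lra.
Qed.

(* A sinusoid is concave relative to the sines, so where it is [>= 1] at both ends of an
   interval of length [< PI] it is [>= 1] inside. *)
Lemma disk_profile_ge_1_between p w a b y : a < y < b -> b - a < PI ->
  1 <= disk_profile p w a -> 1 <= disk_profile p w b -> 1 <= disk_profile p w y.
Proof.
  intros Hy Hab Ha Hb.
  assert (H : disk_profile p w y * sin (b - a) =
    disk_profile p w a * sin (b - y) + disk_profile p w b * sin (y - a)).
  { unfold disk_profile.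
    replace (b - a) with ((b - w) - (a - w)) by ring.
    replace (b - y) with ((b - w) - (y - w)) by ring.
    replace (y - a) with ((y - w) - (a - w)) by ring.
    rewrite (sin_minus (b - w) (a - w)), (sin_minus (b - w) (y - w)),
      (sin_minus (y - w) (a - w)). ring. }
  assert (Hs : sin (b - a) = sin (b - y) * cos (y - a) + cos (b - y) * sin (y - a)).
  { rewrite <- sin_plus. f_equal. ring. }
  assert (H0 : 0 < sin (b - a)) by (apply sin_gt_0; lra).
  assert (H1 : 0 < sin (b - y)) by (apply sin_gt_0; lra).
  assert (H2 : 0 < sin (y - a)) by (apply sin_gt_0; lra).
  pose proof (COS_bound (y - a)). pose proof (COS_bound (b - y)).
  apply Rmult_le_reg_r with (1 := H0). nra.
Qed.

Lemma disk_profile_opp p w y : disk_profile p (- w) (- y) = disk_profile p w y.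
Proof.
  unfold disk_profile. replace (- y - - w) with (- (y - w)) by ring.
  rewrite cos_neg, sin_neg. replace ((- w) ^ 2) with (w ^ 2) by ring. ring.
Qed.

(** A branch centred at [w] could leave [-PI, PI]. If [y > PI], then either [y - w = PI], where the
    profile is the negative of its value at [w], or the profile is at least 1 at PI by
    [disk_profile_ge_1_between], against the comparison, which puts it below
    [cosh_sqrt (p^2 - PI^2) <= 1]. Reflection handles [y < - PI]. *)
Lemma disk_profile_arg p w y : 0 < p < PI -> - p <= w <= p ->
  Rabs (y - w) <= PI -> 1 <= disk_profile p w y -> - PI <= y <= PI.
Proof.
  intros Hp.
  assert (aux : forall w y, - p <= w <= p ->
    Rabs (y - w) <= PI -> 1 <= disk_profile p w y -> y <= PI).
  { clear w y. intros w y Hw Hyw H. apply Rnot_lt_le. intros Hy.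
    apply Rabs_le_between in Hyw.
    assert (Hd : 1 <= disk_profile p w w).
    { rewrite disk_profile_diag. apply cosh_sqrt_ge_1. nra. }
    destruct (Req_dec (y - w) PI) as [He|Hne].
    - unfold disk_profile in H. rewrite disk_profile_diag in Hd.
      rewrite He, cos_PI, sin_PI in H. lra.
    - pose proof (disk_profile_ge_1_between p w w y PI ltac:(lra) ltac:(lra) Hd H).
      pose proof (disk_profile_lt p w PI Hp Hw ltac:(lra)
        ltac:(apply Rabs_le; lra) ltac:(lra)).
      pose proof (cosh_sqrt_le_1 (p ^ 2 - PI ^ 2) ltac:(nra)). lra. }
  intros Hw Hyw H. split; [|now apply (aux w)].
  enough (- y <= PI) by lra. apply (aux (- w)).
  - lra.
  - rewrite <- Rabs_Ropp. now replace (- (- y - - w)) with (y - w) by ring.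
  - now rewrite disk_profile_opp.
Qed.

(** Orthogonality keeps 0 out of the disk, so a logarithm exists. The alternative separates interior
    points of the set from contact points, and so serves both the inclusion and the description of
    the boundary contact. *)
Lemma Dset_centre_log p w z : 0 < p < PI -> - p <= w <= p ->
  Dset (centre p w) (radius p w) z ->
  exists x y, z = Cexp (x, y) /\ (x ^ 2 + y ^ 2 < p ^ 2 \/ (y = w /\ x ^ 2 = p ^ 2 - w ^ 2)).
Proof.
  intros Hp Hw Hz.
  assert (Hw2 : w ^ 2 <= p ^ 2) by nra.
  assert (Hz0 : z <> 0%C).
  { intros ->. unfold Dset in Hz.
    pose proof (centre_orthogonal p w). pose proof (radius_pos p w ltac:(lra) Hw2).
    replace (Cminus 0 (centre p w)) with (Copp (centre p w)) in Hz by ring.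
    rewrite Cmod_opp in Hz. pose proof (Cmod_ge_0 (centre p w)). nra. }
  destruct (Cexp_surj z w Hz0) as [x [y [-> Hyw]]].
  apply Dset_centre in Hz; [|lra|easy].
  pose proof (cosh_ge_1 x).
  pose proof (disk_profile_arg p w y Hp Hw Hyw ltac:(lra)) as Hy.
  exists x, y. split; [easy|].
  destruct (Req_dec y w) as [->|Hne].
  - rewrite disk_profile_diag in Hz. apply cosh_le_cosh_sqrt in Hz; [|lra].
    destruct (Req_dec (x ^ 2) (p ^ 2 - w ^ 2)); [now right | left; lra].
  - left. pose proof (disk_profile_lt p w y Hp Hw Hy Hyw Hne).
    pose proof (cosh_lt_cosh_sqrt x (p ^ 2 - y ^ 2) ltac:(lra)). lra.
Qed.

Lemma Cmod_le_sqr (x y r : R) : 0 <= r -> Cmod (x, y) <= r <-> x ^ 2 + y ^ 2 <= r ^ 2.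
Proof.
  intros Hr. pose proof (Cmod_sqr (x, y)) as H. cbn [fst snd] in H. rewrite <- H.
  pose proof (Cmod_ge_0 (x, y)). split; intros; nra.
Qed.

Lemma Dset_centre_subset p w : 0 < p < PI -> - p <= w <= p ->
  subset (Dset (centre p w) (radius p w)) (expD p).
Proof.
  intros Hp Hw z Hz. destruct (Dset_centre_log p w z Hp Hw Hz) as [x [y [-> H]]].
  exists (x, y). split; [|easy]. apply Cmod_le_sqr; [lra|].
  destruct H as [H|[-> H]]; lra.
Qed.

(** * Interior and boundary of the exponential image *)

Lemma Cexp_inj x y x' y' : - PI < y < PI -> - PI < y' < PI ->
  Cexp (x, y) = Cexp (x', y') -> x = x' /\ y = y'.
Proof.
  intros Hy Hy' H. unfold Cexp in H. cbn [fst snd] in H. injection H as H1 H2.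
  pose proof (exp_pos x). pose proof (exp_pos x').
  pose proof (sin2_cos2 y) as E1. pose proof (sin2_cos2 y') as E2. unfold Rsqr in E1, E2.
  assert (He : exp x = exp x').
  { assert (exp x ^ 2 = exp x' ^ 2); [|nra].
    transitivity ((exp x * cos y) ^ 2 + (exp x * sin y) ^ 2); [nra|].
    rewrite H1, H2. nra. }
  split; [now apply exp_inv|].
  rewrite He in H1, H2.
  apply Rmult_eq_reg_l in H1; [|lra]. apply Rmult_eq_reg_l in H2; [|lra].
  (* Half the difference of the angles lies in (-PI, PI), where sine vanishes only at 0. *)
  assert (Hc : cos (2 * ((y - y') / 2)) = 1).
  { replace (2 * ((y - y') / 2)) with (y - y') by field. rewrite cos_minus. nra. }
  rewrite cos_2a_sin in Hc.
  assert (Hs : sin ((y - y') / 2) = 0) by nra.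
  destruct (Rtotal_order y y') as [Hl|[Hl|Hl]]; [|easy|].
  - assert (0 < sin (- ((y - y') / 2))) by (apply sin_gt_0; lra).
    rewrite sin_neg in *. lra.
  - assert (0 < sin ((y - y') / 2)) by (apply sin_gt_0; lra). lra.
Qed.

Lemma Clog_near_1 (delta : R) : 0 < delta -> exists eps, 0 < eps /\
  forall v, Cmod (Cminus v 1) < eps ->
  exists a b, v = Cexp (a, b) /\ Rabs a < delta /\ Rabs b < delta.
Proof.
  intros Hd.
  destruct (proj1 (filterlim_locally _ _) (continuous_ln 1 Rlt_0_1) (mkposreal _ Hd)) as [e1 H1].
  destruct (proj1 (filterlim_locally _ _) (continuous_atan 0) (mkposreal _ Hd)) as [e2 H2].
  pose proof (cond_pos e1). pose proof (cond_pos e2).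
  (* The bound 1/2 forces the real part [a] of [v] above 1/2; then an imaginary part below [e2 / 2]
     gives [b / a] below [e2] in absolute value. *)
  exists (Rmin (1 / 2) (Rmin e1 (e2 / 2))).
  split; [repeat apply Rmin_glb_lt; lra|].
  intros v Hv.
  assert (Hv0 := Rlt_le_trans _ _ _ Hv (Rmin_l _ _)).
  assert (Hv' := Rlt_le_trans _ _ _ Hv (Rmin_r _ _)).
  assert (Hv1 := Rlt_le_trans _ _ _ Hv' (Rmin_l _ _)).
  assert (Hv2 := Rlt_le_trans _ _ _ Hv' (Rmin_r _ _)).
  clear Hv Hv'.
  assert (Hmod : Rabs (Cmod v - 1) <= Cmod (Cminus v 1)).
  { pose proof (Cmod_triangle (Cminus v 1) 1) as T1.
    pose proof (Cmod_triangle v (Copp (Cminus v 1))) as T2.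
    rewrite Cmod_opp in T2.
    replace (Cplus (Cminus v 1) 1) with v in T1 by ring.
    replace (Cplus v (Copp (Cminus v 1))) with (RtoC 1) in T2 by ring.
    rewrite Cmod_1 in *. apply Rabs_le. lra. }
  pose proof (Rmax_Cmod (Cminus v 1)) as Hmax.
  pose proof (Rmax_l (Rabs (fst (Cminus v 1))) (Rabs (snd (Cminus v 1)))) as Hre.
  pose proof (Rmax_r (Rabs (fst (Cminus v 1))) (Rabs (snd (Cminus v 1)))) as Him.
  pose proof (Cmod_sqr v) as Hsq.
  destruct v as [a b]. cbn [fst snd Cminus Cplus Copp RtoC] in *.
  replace (b + - 0) with b in Him, Hre, Hmax by ring.
  assert (Ha : 1 / 2 < a).
  { pose proof (Rle_abs (- (a + - (1)))). rewrite Rabs_Ropp in *. lra. }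
  set (m := Cmod (a, b)) in *.
  assert (Hm0 : 0 < m).
  { pose proof (Rle_abs (- (m - 1))). rewrite Rabs_Ropp in *. lra. }
  exists (ln m), (atan (b / a)).
  assert (Hs : sqrt (1 + Rsqr (b / a)) = m / a).
  { apply sqrt_lem_1.
    - pose proof (Rle_0_sqr (b / a)). lra.
    - apply Rlt_le, Rdiv_lt_0_compat; lra.
    - transitivity (m ^ 2 / a ^ 2); [field; lra|]. rewrite Hsq. unfold Rsqr. field. lra. }
  split; [|split].
  - unfold Cexp. cbn [fst snd]. rewrite exp_ln, cos_atan, sin_atan, Hs by easy.
    f_equal; field; lra.
  - specialize (H1 m). rewrite ln_1 in H1.
    change (Rabs (m - 1) < e1 -> Rabs (ln m - 0) < delta) in H1.
    rewrite Rminus_0_r in H1. apply H1. lra.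
  - specialize (H2 (b / a)). rewrite atan_0 in H2.
    change (Rabs (b / a - 0) < e2 -> Rabs (atan (b / a) - 0) < delta) in H2.
    rewrite !Rminus_0_r in H2. apply H2.
    unfold Rdiv. rewrite Rabs_mult, Rabs_inv, (Rabs_pos_eq a) by lra.
    apply Rmult_lt_reg_r with a; [lra|]. rewrite Rmult_assoc, Rinv_l by lra. nra.
Qed.

Lemma Cexp_add x y a b : Cexp (x + a, y + b) = Cmult (Cexp (x, y)) (Cexp (a, b)).
Proof.
  unfold Cexp, Cmult. cbn [fst snd]. rewrite exp_plus, cos_plus, sin_plus. f_equal; ring.
Qed.

Lemma Cmod_Cexp x y : Cmod (Cexp (x, y)) = exp x.
Proof.
  pose proof (Cmod_sqr (Cexp (x, y))) as H. unfold Cexp in *. cbn [fst snd] in *.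
  pose proof (sin2_cos2 y). unfold Rsqr in *. pose proof (exp_pos x).
  set (m := Cmod _) in *. assert (0 <= m) by apply Cmod_ge_0.
  assert (m ^ 2 = exp x ^ 2) by (rewrite H; nra). nra.
Qed.

(** The exponential is open: a point near [Cexp (x, y)] is its product with some [Cexp (a, b)] for
    small [a] and [b], so it has the logarithm [(x + a, y + b)], still of modulus below [p]. *)
Lemma expD_interior p x y : 0 < p -> x ^ 2 + y ^ 2 < p ^ 2 -> ~ boundary (expD p) (Cexp (x, y)).
Proof.
  intros Hp H HB.
  assert (Hm : Cmod (x, y) < p).
  { pose proof (Cmod_sqr (x, y)) as Hs. cbn [fst snd] in Hs.
    pose proof (Cmod_ge_0 (x, y)). nra. }
  destruct (Clog_near_1 ((p - Cmod (x, y)) / 2)) as [eps [He Hlog]]; [lra|].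
  pose proof (exp_pos x) as Hx.
  destruct (HB (exp x * eps)) as [_ [z [Hz Hzd]]]; [nra|]. apply Hz.
  assert (Hq0 : Cexp (x, y) <> 0%C) by (apply Cmod_gt_0; rewrite Cmod_Cexp; easy).
  destruct (Hlog (Cdiv z (Cexp (x, y)))) as [a [b [Hv [Ha Hb]]]].
  { apply Rmult_lt_reg_l with (1 := Hx). rewrite <- (Cmod_Cexp x y) at 1.
    rewrite <- Cmod_mult.
    now replace (Cmult (Cexp (x, y)) (Cminus (Cdiv z (Cexp (x, y))) 1))
      with (Cminus z (Cexp (x, y))) by (field; easy). }
  exists (x + a, y + b). split.
  - pose proof (Cmod_triangle (x, y) (a, b)) as T.
    assert (Hab : Cmod (a, b) <= Rabs a + Rabs b).
    { apply Cmod_le_sqr; [pose proof (Rabs_pos a); pose proof (Rabs_pos b); lra|].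
      rewrite <- (pow2_abs a), <- (pow2_abs b).
      pose proof (Rabs_pos a); pose proof (Rabs_pos b); nra. }
    change (Cmod (x + a, y + b) <= Cmod (x, y) + Cmod (a, b)) in T. lra.
  - rewrite Cexp_add, <- Hv. field. easy.
Qed.

Lemma continuous_Cmod (f g : R -> R) (x : R) : continuous f x -> continuous g x ->
  continuous (fun t => Cmod (f t, g t)) x.
Proof.
  intros Hf Hg. unfold Cmod. cbn [fst snd].
  apply continuous_comp; [|apply continuous_sqrt].
  apply (continuous_plus (fun t => f t ^ 2) (fun t => g t ^ 2)); simpl;
    repeat apply (continuous_mult (K := R_AbsRing)); assumption || apply continuous_const.
Qed.

(** Moving the logarithm outward to [(l * x, l * y)] with [l > 1] leaves the set, since [Cexp] is
    injective on the strip of imaginary parts in (-PI, PI). *)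
Lemma expD_boundary p x y : 0 < p < PI -> x ^ 2 + y ^ 2 = p ^ 2 -> boundary (expD p) (Cexp (x, y)).
Proof.
  intros Hp H eps He. split.
  { exists (Cexp (x, y)). split.
    - exists (x, y). split; [|easy]. apply Cmod_le_sqr; lra.
    - replace (Cminus (Cexp (x, y)) (Cexp (x, y))) with (RtoC 0) by ring. now rewrite Cmod_0. }
  set (f := fun l => Cmod (Cminus (Cexp (l * x, l * y)) (Cexp (x, y)))).
  assert (Hf : continuous f 1).
  { unfold f, Cexp. apply continuous_Cmod; cbn [fst snd];
      (apply (ex_derive_continuous (V := R_NormedModule)); auto_derive; easy). }
  destruct (proj1 (filterlim_locally _ _) Hf (mkposreal _ He)) as [d Hd].
  pose proof (cond_pos d).
  (* The first bound keeps the image within [eps]; the second gives [l * p <= (p + PI) / 2 < PI], so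
     the point stays in the strip. *)
  set (l := 1 + Rmin (d / 2) ((PI - p) / (2 * p))).
  assert (Hl0 : 0 < Rmin (d / 2) ((PI - p) / (2 * p))).
  { apply Rmin_glb_lt; [lra|]. apply Rdiv_lt_0_compat; lra. }
  pose proof (Rmin_l (d / 2) ((PI - p) / (2 * p))) as Hl1.
  pose proof (Rmin_r (d / 2) ((PI - p) / (2 * p))) as Hl2.
  set (h := Rmin _ _) in *.
  assert (Hl3 : l * p < PI).
  { apply (Rmult_le_compat_r p) in Hl2; [|lra].
    replace ((PI - p) / (2 * p) * p) with ((PI - p) / 2) in Hl2 by (field; lra).
    unfold l. lra. }
  exists (Cexp (l * x, l * y)). split.
  - intros [[a b] [Hab Heq]]. apply Cmod_le_sqr in Hab; [|lra].
    apply Cexp_inj in Heq.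
    + destruct Heq as [<- <-].
      assert (1 < l) by (unfold l; lra). assert (0 < p ^ 2) by nra.
      assert (l ^ 2 * p ^ 2 <= p ^ 2) by (rewrite <- H at 1; lra).
      assert (1 < l ^ 2) by nra. nra.
    + assert (- p <= y <= p) by nra. assert (1 < l) by (unfold l; lra). split; nra.
    + assert (- p <= b <= p) by nra. lra.
  - specialize (Hd l).
    change (Rabs (l - 1) < d -> Rabs (f l - f 1) < eps) in Hd.
    assert (Hf1 : f 1 = 0).
    { unfold f. rewrite !Rmult_1_l.
      replace (Cminus (Cexp (x, y)) (Cexp (x, y))) with (RtoC 0) by ring. apply Cmod_0. }
    rewrite Hf1, Rminus_0_r in Hd. apply Rle_lt_trans with (1 := Rle_abs _). apply Hd.
    rewrite Rabs_pos_eq; unfold l; lra.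
Qed.

Lemma dist_contact p w x : 0 < p -> w ^ 2 <= p ^ 2 -> x ^ 2 = p ^ 2 - w ^ 2 ->
  Cmod (Cminus (Cexp (x, w)) (centre p w)) = radius p w.
Proof.
  intros Hp Hw Hx. pose proof (dist_centre p w x w) as H.
  rewrite exp_sqr_cosh, disk_profile_diag, <- Hx, cosh_sqrt_sqr in H.
  pose proof (radius_pos p w Hp Hw).
  pose proof (Cmod_ge_0 (Cminus (Cexp (x, w)) (centre p w))). nra.
Qed.

Lemma Dset_centre_boundary p w z : 0 < p < PI -> - p <= w <= p ->
  Dset (centre p w) (radius p w) z /\ boundary (expD p) z <->
  exists x, x ^ 2 = p ^ 2 - w ^ 2 /\ z = Cexp (x, w).
Proof.
  intros Hp Hw. split.
  - intros [Hz HB]. destruct (Dset_centre_log p w z Hp Hw Hz) as [x [y [-> [H|[-> H]]]]].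
    + now apply expD_interior in HB.
    + now exists x.
  - intros [x [Hx ->]]. split.
    + apply Req_le, dist_contact; [lra|nra|easy].
    + apply expD_boundary; lra.
Qed.

(** * Enclosing a disk by maximization over the index *)

(** The first-order condition takes the form of a variational inequality so that it also covers a
    maximum at an endpoint. *)
Lemma derive_at_max f l a b x : is_derive f x l -> a <= x <= b ->
  (forall y, a <= y <= b -> f y <= f x) -> forall y, a <= y <= b -> l * (y - x) <= 0.
Proof.
  intros Hf Hx Hmax y Hy. apply Rnot_lt_le. intros Hl.
  apply is_derive_Reals in Hf.
  assert (Hl0 : 0 < Rabs l) by (apply Rabs_pos_lt; nra).
  destruct (Hf _ Hl0) as [d Hd].
  pose proof (cond_pos d) as Hd0.
  assert (Hyx0 : y - x <> 0) by (intros E; rewrite E in Hl; lra).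
  assert (Hyx : 0 < Rabs (y - x)) by now apply Rabs_pos_lt.
  (* [k <= 1] keeps [x + k * (y - x)] in the interval, and the other bound keeps the increment below
     [d]. *)
  set (k := Rmin 1 (d / (2 * Rabs (y - x)))).
  assert (Hk0 : 0 < k).
  { apply Rmin_glb_lt; [lra|]. apply Rdiv_lt_0_compat; lra. }
  assert (Hk1 : k <= 1) by apply Rmin_l.
  assert (Hk2 : k * Rabs (y - x) <= d / 2).
  { apply Rle_trans with (d / (2 * Rabs (y - x)) * Rabs (y - x)).
    - apply Rmult_le_compat_r; [lra|]. apply Rmin_r.
    - apply Req_le. field. lra. }
  set (h := k * (y - x)).
  assert (Hh : h <> 0) by (apply Rmult_integral_contrapositive_currified; lra).
  specialize (Hd h Hh).
  assert (Hhd : Rabs h < d) by (unfold h; rewrite Rabs_mult, (Rabs_pos_eq k); lra).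
  specialize (Hd Hhd).
  assert (Hfh : f (x + h) <= f x) by (apply Hmax; unfold h; nra).
  assert (Hlh : 0 < l * h) by (unfold h; nra).
  set (q := (f (x + h) - f x) / h) in *.
  assert (Hq : q * h <= 0) by (unfold q; field_simplify; lra).
  assert (Hc : Rabs (q - l) * Rabs h < Rabs l * Rabs h)
    by (apply Rmult_lt_compat_r; [now apply Rabs_pos_lt | easy]).
  rewrite <- !Rabs_mult, (Rabs_pos_eq (l * h)) in Hc by lra.
  pose proof (Rle_abs (- ((q - l) * h))). rewrite Rabs_Ropp in *. lra.
Qed.

Lemma is_derive_Cmod (f g : R -> R) (x a b : R) : is_derive f x a -> is_derive g x b ->
  0 < Cmod (f x, g x) ->
  is_derive (fun t => Cmod (f t, g t)) x ((f x * a + g x * b) / Cmod (f x, g x)).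
Proof.
  intros Hf Hg H0.
  assert (Hs : 0 < f x ^ 2 + g x ^ 2).
  { pose proof (Cmod_sqr (f x, g x)) as H. cbn [fst snd] in H. rewrite <- H. nra. }
  unfold Cmod in *. cbn [fst snd] in *.
  auto_derive.
  - repeat split; try (eexists; eassumption). simpl in Hs. lra.
  - replace (Derive (fun t => f t) x) with a by (symmetry; now apply is_derive_unique).
    replace (Derive (fun t => g t) x) with b by (symmetry; now apply is_derive_unique).
    simpl in *. field.
    intros H. rewrite H in H0. lra.
Qed.

Lemma is_derive_radius p w :
  is_derive (radius p) w (- (2 * p * w * sinhc_sqrt' (p ^ 2 - w ^ 2))).
Proof.
  unfold radius. auto_derive.
  - apply ex_derive_sinhc_sqrt.
  - rewrite Derive_sinhc_sqrt. replace (p ^ 2 - w ^ 2) with (p * (p * 1) + - (w * (w * 1))) by ring.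
    ring.
Qed.

(* The derivative of the centre is [2 p^2 sinhc_sqrt' (p^2 - w^2) i e^{iw}]. *)
Lemma is_derive_fst_centre p w :
  is_derive (fun t => fst (centre p t)) w (- (2 * p ^ 2 * sinhc_sqrt' (p ^ 2 - w ^ 2) * sin w)).
Proof.
  unfold centre. cbn [fst]. auto_derive.
  - repeat split; (apply ex_derive_cosh_sqrt || apply ex_derive_sinhc_sqrt).
  - rewrite Derive_cosh_sqrt, Derive_sinhc_sqrt, cosh_sqrt_eq.
    replace (p ^ 2 - w ^ 2) with (p * (p * 1) + - (w * (w * 1))) by ring. field.
Qed.

Lemma is_derive_snd_centre p w :
  is_derive (fun t => snd (centre p t)) w (2 * p ^ 2 * sinhc_sqrt' (p ^ 2 - w ^ 2) * cos w).
Proof.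
  unfold centre. cbn [snd]. auto_derive.
  - repeat split; (apply ex_derive_cosh_sqrt || apply ex_derive_sinhc_sqrt).
  - rewrite Derive_cosh_sqrt, Derive_sinhc_sqrt, cosh_sqrt_eq.
    replace (p ^ 2 - w ^ 2) with (p * (p * 1) + - (w * (w * 1))) by ring. field.
Qed.

Lemma Dset_subset (c c' : C) (r r' : R) :
  Cmod (Cminus c c') + r <= r' -> subset (Dset c r) (Dset c' r').
Proof.
  intros H z Hz. unfold Dset in *.
  replace (Cminus z c') with (Cplus (Cminus z c) (Cminus c c')) by ring.
  pose proof (Cmod_triangle (Cminus z c) (Cminus c c')). lra.
Qed.

Lemma Dset_avoids_boundary (S : C -> Prop) (c z : C) (r : R) :
  subset (Dset c r) S -> boundary S z -> r <= Cmod (Cminus z c).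
Proof.
  intros HS HB. apply Rnot_lt_le. intros H.
  destruct (HB (r - Cmod (Cminus z c))) as [_ [w [Hw Hwz]]]; [lra|].
  apply Hw, HS. unfold Dset.
  replace (Cminus w c) with (Cplus (Cminus w z) (Cminus z c)) by ring.
  pose proof (Cmod_triangle (Cminus w z) (Cminus z c)). lra.
Qed.

(** The disk of index [y] contains the whole slice of the set at height [y], as its profile there is
    [cosh_sqrt (p^2 - y^2)]. This makes the maximum in the next lemma nonnegative. *)
Lemma expD_in_Dset_centre p c : 0 < p -> expD p c ->
  exists w, - p <= w <= p /\ Dset (centre p w) (radius p w) c.
Proof.
  intros Hp [[x y] [H ->]]. apply Cmod_le_sqr in H; [|lra].
  exists y. split; [nra|]. apply Dset_centre; [lra|nra|].
  rewrite disk_profile_diag, <- cosh_sqrt_sqr.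
  destruct (Rle_lt_or_eq_dec (x ^ 2) (p ^ 2 - y ^ 2) ltac:(lra)) as [Hlt| ->]; [|lra].
  apply Rlt_le, cosh_sqrt_increasing; [apply pow2_ge_0 | easy].
Qed.

(* Choose [w] maximizing [radius p w - |c - centre p w|]. By the first-order condition the point of
   the circle nearest to [c] is one of its contact points with the boundary of [expD p], so
   [D(c,r)] cannot reach beyond it. *)
Lemma disk_in_Dset_centre p c r : 0 < p < PI -> 0 <= r -> subset (Dset c r) (expD p) ->
  exists w, - p <= w <= p /\ Cmod (Cminus c (centre p w)) + r <= radius p w.
Proof.
  intros Hp Hr HS.
  set (f := fun w => fst c - fst (centre p w)).
  set (g := fun w => snd c - snd (centre p w)).
  assert (Hfg : forall w, Cminus c (centre p w) = (f w, g w)) by reflexivity.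
  assert (Hf : forall w, is_derive f w (2 * p ^ 2 * sinhc_sqrt' (p ^ 2 - w ^ 2) * sin w)).
  { intros w. replace (2 * p ^ 2 * sinhc_sqrt' (p ^ 2 - w ^ 2) * sin w)
      with (0 - (- (2 * p ^ 2 * sinhc_sqrt' (p ^ 2 - w ^ 2) * sin w))) by ring.
    apply (is_derive_minus (fun _ => fst c) (fun t => fst (centre p t)));
      [apply (is_derive_const (fst c)) | apply is_derive_fst_centre]. }
  assert (Hg : forall w, is_derive g w (- (2 * p ^ 2 * sinhc_sqrt' (p ^ 2 - w ^ 2) * cos w))).
  { intros w. replace (- (2 * p ^ 2 * sinhc_sqrt' (p ^ 2 - w ^ 2) * cos w))
      with (0 - (2 * p ^ 2 * sinhc_sqrt' (p ^ 2 - w ^ 2) * cos w)) by ring.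
    apply (is_derive_minus (fun _ => snd c) (fun t => snd (centre p t)));
      [apply (is_derive_const (snd c)) | apply is_derive_snd_centre]. }
  set (phi := fun w => radius p w - Cmod (f w, g w)).
  destruct (continuity_ab_maj phi (- p) p ltac:(lra)) as [w [Hmax Hw]].
  { intros w _. apply continuity_pt_filterlim.
    apply (continuous_minus (radius p)).
    - apply (ex_derive_continuous (radius p)). eexists. apply is_derive_radius.
    - apply continuous_Cmod; [apply (ex_derive_continuous f) | apply (ex_derive_continuous g)];
        eexists; [apply Hf | apply Hg]. }
  exists w. split; [easy|]. rewrite Hfg.
  set (d := Cmod (f w, g w)).
  assert (Hw2 : w ^ 2 <= p ^ 2) by nra.
  assert (Hd : d <= radius p w).
  { destruct (expD_in_Dset_centre p c) as [y [Hy Hcy]]; [lra| |].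
    - apply HS. unfold Dset. replace (Cminus c c) with (RtoC 0) by ring. now rewrite Cmod_0.
    - specialize (Hmax y Hy). unfold Dset in Hcy. rewrite Hfg in Hcy.
      unfold phi in Hmax. fold d in Hmax. lra. }
  assert (HB : forall x, x ^ 2 = p ^ 2 - w ^ 2 -> r <= Cmod (Cminus (Cexp (x, w)) c)).
  { intros x Hx. apply Dset_avoids_boundary with (1 := HS). apply expD_boundary; lra. }
  assert (Hd0 : 0 <= d) by apply Cmod_ge_0.
  (* The distance is not differentiable where it vanishes; in that case [c] is the centre and any
     contact point bounds [r] by the radius. *)
  destruct (Rle_lt_or_eq_dec _ _ Hd0) as [Hdp|Hdz].
  2:{ rewrite <- Hdz. specialize (HB (sqrt (p ^ 2 - w ^ 2)) ltac:(apply pow2_sqrt; lra)).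
      assert (Hc : c = centre p w).
      { assert (H0 : Cminus c (centre p w) = 0%C) by (apply Cmod_eq_0; rewrite Hfg; easy).
        transitivity (Cplus (Cminus c (centre p w)) (centre p w)); [ring|]. rewrite H0. ring. }
      rewrite Hc, dist_contact in HB; [lra|lra|easy|apply pow2_sqrt; lra]. }
  set (k := sinhc_sqrt' (p ^ 2 - w ^ 2)).
  assert (Hk : 0 < k) by (apply sinhc_sqrt'_pos; nra).
  (* In the rotated frame, [c - centre p w] is d (nu + i sg) e^{iw}. *)
  set (sg := (g w * cos w - f w * sin w) / d).
  set (nu := (f w * cos w + g w * sin w) / d).
  assert (Hdd : d ^ 2 = f w ^ 2 + g w ^ 2) by (unfold d; now rewrite Cmod_sqr).
  pose proof (sin2_cos2 w) as Hsc.
  assert (Hn : nu ^ 2 + sg ^ 2 = 1).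
  { transitivity ((f w ^ 2 + g w ^ 2) * (Rsqr (sin w) + Rsqr (cos w)) / d ^ 2).
    - unfold nu, sg, Rsqr. field. lra.
    - rewrite Hsc, <- Hdd. field. lra. }
  assert (Hphi : is_derive phi w (2 * p * k * (p * sg - w))).
  { replace (2 * p * k * (p * sg - w)) with
      (- (2 * p * w * k) - (f w * (2 * p ^ 2 * k * sin w) + g w * - (2 * p ^ 2 * k * cos w)) / d)
      by (unfold sg; field; lra).
    apply (is_derive_minus (radius p)); [apply is_derive_radius|].
    now apply is_derive_Cmod. }
  assert (Hsg : - p <= p * sg <= p) by nra.
  (* Testing with [p * sg], which lies in the interval, yields 2 p k (p sg - w)^2 <= 0 and hence
     [p * sg = w], even when [w] is an endpoint. *)
  pose proof (derive_at_max phi _ (- p) p w Hphi Hw Hmax (p * sg) Hsg) as Hle.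
  assert (Hsw : p * sg = w).
  { assert (0 < 2 * p * k) by nra.
    assert ((p * sg - w) ^ 2 <= 0) by nra. nra. }
  assert (Hx : (p * nu) ^ 2 = p ^ 2 - w ^ 2) by (rewrite <- Hsw; nra).
  specialize (HB (p * nu) Hx).
  (* Since [exp (p * nu) = cosh_sqrt (p^2 - w^2) + radius p w * nu], the contact point lies on the
     ray from the centre through [c]; its distance to [c] is therefore [radius p w - d]. *)
  assert (Hz : Cminus (Cexp (p * nu, w)) c =
    Cmult (RtoC ((radius p w - d) / d)) (f w, g w)).
  { assert (He : exp (p * nu) = cosh_sqrt (p ^ 2 - w ^ 2) + radius p w * nu).
    { unfold radius. rewrite <- Hx, exp_cosh_sqrt. ring. }
    assert (Hc : c = (fst (centre p w) + f w, snd (centre p w) + g w)).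
    { unfold f, g. destruct c. cbn [fst snd]. f_equal; ring. }
    assert (Hf' : f w = d * (nu * cos w - sg * sin w)).
    { transitivity (f w * (Rsqr (sin w) + Rsqr (cos w))); [rewrite Hsc; ring|].
      unfold nu, sg, Rsqr. field. lra. }
    assert (Hg' : g w = d * (nu * sin w + sg * cos w)).
    { transitivity (g w * (Rsqr (sin w) + Rsqr (cos w))); [rewrite Hsc; ring|].
      unfold nu, sg, Rsqr. field. lra. }
    assert (Hws : w * sinhc_sqrt (p ^ 2 - w ^ 2) = radius p w * sg).
    { unfold radius. rewrite <- Hsw at 1. ring. }
    rewrite Hc. unfold Cexp, Cminus, Cplus, Copp, Cmult, RtoC. cbn [fst snd].
    rewrite He. unfold centre. cbn [fst snd]. rewrite Hws.
    generalize dependent (f w). generalize dependent (g w). intros gw. intros.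
    rewrite Hf', Hg'. f_equal; field; lra. }
  rewrite Hz, Cmod_mult, Cmod_R in HB. fold d in HB.
  rewrite Rabs_pos_eq in HB by (apply Rcomplements.Rdiv_le_0_compat; lra).
  replace ((radius p w - d) / d * d) with (radius p w - d) in HB by (field; lra). lra.
Qed.

(** * Tangency and osculation *)

(** The chain rule applied to [dist_centre] along the curve, kept explicit so that it can be
    differentiated again for osculation. *)
Definition dist_sqr_deriv (p w s : R) : R :=
  let x := p * cos s in
  let y := p * sin s in
  2 * exp x * (- (p * sin s) * (exp x - disk_profile p w y) +
    p * cos s * (cosh_sqrt (p ^ 2 - w ^ 2) * sin (y - w) +
                 w * sinhc_sqrt (p ^ 2 - w ^ 2) * cos (y - w))).

Lemma is_derive_dist_sqr p w s :
  is_derive (fun s => Cmod (Cminus (Gamma p s) (centre p w)) ^ 2) s (dist_sqr_deriv p w s).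
Proof.
  eapply is_derive_ext.
  { intros t. symmetry. apply dist_centre. }
  unfold dist_sqr_deriv, disk_profile.
  generalize (cosh_sqrt (p ^ 2 - w ^ 2)) (sinhc_sqrt (p ^ 2 - w ^ 2)) (radius p w). intros c k r.
  auto_derive; [easy|]. unfold Rminus. ring.
Qed.

(** With x = p cos s, the difference [exp x - disk_profile p w w] is sinh x, that is,
    [x * sinhc_sqrt (x^2)], and the two terms of [dist_sqr_deriv] cancel. The sign of [cos s] is
    free, so both contact points are covered. *)
Lemma circle_tangent_contact p w s : 0 < p -> p * sin s = w ->
  circle_tangent_at (Gamma p) (Cexp (p * cos s, w)) (centre p w) (radius p w).
Proof.
  intros Hp Hs.
  assert (Hu : p ^ 2 - w ^ 2 = (p * cos s) ^ 2) by (rewrite <- Hs; apply sub_sqr_sin).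
  exists s. split; [|split].
  - unfold Gamma. now rewrite Hs.
  - pose proof (pow2_ge_0 (p * cos s)). apply dist_contact; lra.
  - replace 0 with (dist_sqr_deriv p w s); [apply is_derive_dist_sqr|].
    unfold dist_sqr_deriv. rewrite Hs, disk_profile_diag, Rminus_diag, cos_0, sin_0, Hu.
    rewrite exp_cosh_sqrt. ring.
Qed.

(** When [cos s = 0], both [cosh_sqrt] and [sinhc_sqrt] are evaluated at 0 and equal 1. The bracket
    in [dist_sqr_deriv] vanishes, and its derivative is w^2 - w^2. *)
Lemma circle_osculating_contact p w s : 0 < p -> p * sin s = w -> cos s = 0 ->
  circle_osculating_at (Gamma p) (Cexp (p * cos s, w)) (centre p w) (radius p w).
Proof.
  intros Hp Hs Hc.
  assert (Hu : p ^ 2 - w ^ 2 = 0) by (rewrite <- Hs, sub_sqr_sin, Hc; ring).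
  exists s. split; [|split; [|split]].
  - unfold Gamma. now rewrite Hs.
  - apply dist_contact; [easy|lra|rewrite Hu, Hc; ring].
  - replace 0 with (dist_sqr_deriv p w s); [apply is_derive_dist_sqr|].
    unfold dist_sqr_deriv. rewrite Hs, disk_profile_diag, Rminus_diag, cos_0, sin_0, Hu, Hc.
    rewrite Rmult_0_r, exp_0, cosh_sqrt_0. ring.
  - apply is_derive_ext with (dist_sqr_deriv p w).
    { intros t. symmetry. apply is_derive_unique, is_derive_dist_sqr. }
    unfold dist_sqr_deriv, disk_profile. rewrite Hu, cosh_sqrt_0, sinhc_sqrt_0.
    auto_derive; [easy|].
    replace (p * sin s + - w) with 0 by (rewrite Hs; ring).
    replace (p * sin s - w) with 0 by (rewrite Hs; ring).
    rewrite Hc, cos_0, sin_0, Rmult_0_r, exp_0.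
    assert (Hss : sin s * sin s = 1).
    { pose proof (sin2_cos2 s) as H. rewrite Hc in H. unfold Rsqr in H. lra. }
    rewrite <- Hs. nra.
Qed.

(** * Inverse points, distinctness and maximality *)

Lemma Cexp_neg_inv_conj x y : Cexp (- x, y) = Cinv (Cconj (Cexp (x, y))).
Proof.
  unfold Cexp, Cinv, Cconj. cbn [fst snd].
  assert (H : (exp x * cos y) ^ 2 + (- (exp x * sin y)) ^ 2 = exp x ^ 2).
  { transitivity (exp x ^ 2 * (Rsqr (sin y) + Rsqr (cos y))); [unfold Rsqr; ring|].
    rewrite sin2_cos2. ring. }
  rewrite H, exp_Ropp. pose proof (exp_pos x). f_equal; field; lra.
Qed.

(** A contact point of the first disk is a boundary point of the set lying in the second disk, hence
    a contact point of the second; its argument is both [w] and [w']. Inclusion in place of equality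
    is what maximality needs. *)
Lemma Dset_centre_inj p w w' : 0 < p < PI -> - p <= w <= p -> - p <= w' <= p ->
  subset (Dset (centre p w) (radius p w)) (Dset (centre p w') (radius p w')) -> w = w'.
Proof.
  intros Hp Hw Hw' HS.
  destruct (proj2 (Dset_centre_boundary p w (Cexp (sqrt (p ^ 2 - w ^ 2), w)) Hp Hw)) as [Hz HB].
  { eexists. split; [|reflexivity]. apply pow2_sqrt. nra. }
  destruct (proj1 (Dset_centre_boundary p w' _ Hp Hw') (conj (HS _ Hz) HB)) as [x [_ Hx]].
  apply Cexp_inj in Hx; lra.
Qed.

(** For the converse, a larger disk in the set lies in some disk of the family; by [Dset_centre_inj]
    that disk has the original index, so all three coincide. *)
Lemma maximal_disk_in_expD p c r : 0 < p < PI -> 0 <= r ->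
  maximal_disk_in (expD p) c r <->
  exists w, - p <= w <= p /\ set_eq (Dset c r) (Dset (centre p w) (radius p w)).
Proof.
  intros Hp Hr. split.
  - intros [HS Hmax].
    destruct (disk_in_Dset_centre p c r Hp Hr HS) as [w [Hw Hd]].
    exists w. split; [easy|]. intros z. symmetry. apply Hmax.
    + apply Rlt_le, radius_pos; nra.
    + now apply Dset_subset.
    + now apply Dset_centre_subset.
  - intros [w [Hw He]]. split.
    + intros z Hz. apply (Dset_centre_subset p w Hp Hw), He, Hz.
    + intros c' r' Hr' HS1 HS2.
      destruct (disk_in_Dset_centre p c' r' Hp Hr' HS2) as [w' [Hw' Hd]].
      apply Dset_subset in Hd.
      assert (w = w').
      { apply (Dset_centre_inj p w w' Hp Hw Hw'). intros z Hz. apply Hd, HS1, He, Hz. }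
      subst w'. intros z. split; intros Hz; [apply He, Hd, Hz | apply HS1, Hz].
Qed.

Lemma mul_sin_bounds p t : 0 < p -> - p <= p * sin t <= p.
Proof. intros Hp. pose proof (SIN_bound t). nra. Qed.

Theorem theorem11p1 (p : R) (hp : 0 < p < PI) :
  (* (a) *)
  (forall t, - (PI / 2) <= t <= PI / 2 ->
     circle_tangent_at (Gamma p) (Cexp (p * cos t, p * sin t)) (Omega p t) (omega p t) /\
     circle_tangent_at (Gamma p) (Cexp (- (p * cos t), p * sin t)) (Omega p t) (omega p t) /\
     Cexp (- (p * cos t), p * sin t) = Cinv (Cconj (Cexp (p * cos t, p * sin t))) /\
     ((t = PI / 2 \/ t = - (PI / 2)) ->
        circle_osculating_at (Gamma p) (Cexp (p * cos t, p * sin t)) (Omega p t) (omega p t)) /\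
     orthogonal_to_unit_circle (Omega p t) (omega p t)) /\
  (forall t1 t2, - (PI / 2) <= t1 <= PI / 2 -> - (PI / 2) <= t2 <= PI / 2 -> t1 <> t2 ->
     ~ set_eq (Dset (Omega p t1) (omega p t1)) (Dset (Omega p t2) (omega p t2))) /\
  (* (b) *)
  (forall t, - (PI / 2) <= t <= PI / 2 ->
     set_eq (CD (W p (p * sin t))) (Dset (Omega p t) (omega p t))) /\
  (* (c) *)
  (forall c r, 0 <= r ->
     (maximal_disk_in (expD p) c r <->
      exists t, - (PI / 2) <= t <= PI / 2 /\
        set_eq (Dset c r) (Dset (Omega p t) (omega p t)))) /\
  (forall t, - (PI / 2) <= t <= PI / 2 ->
     forall z, (Dset (Omega p t) (omega p t) z /\ boundary (expD p) z) <->
       (z = Cexp (p * cos t, p * sin t) \/ z = Cexp (- (p * cos t), p * sin t))).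
Proof.
  assert (Hw : forall t, - p <= p * sin t <= p) by (intros t; apply mul_sin_bounds; lra).
  assert (Hw2 : forall t, (p * sin t) ^ 2 <= p ^ 2) by (intros t; specialize (Hw t); nra).
  split; [|split; [|split; [|split]]].
  - intros t Ht. rewrite Omega_centre, omega_radius by easy.
    split; [|split; [|split; [|split]]].
    + apply circle_tangent_contact; lra.
    (* The second contact point has parameter [PI - t], with the same sine and the opposite
       cosine. *)
    + replace (- (p * cos t)) with (p * cos (PI - t)) by (rewrite Rtrigo_facts.cos_pi_minus; ring).
      apply circle_tangent_contact; [lra|]. now rewrite Rtrigo_facts.sin_pi_minus.
    + apply Cexp_neg_inv_conj.
    + intros Ht'. apply circle_osculating_contact; [lra|easy|].
      destruct Ht' as [->| ->]; [|rewrite cos_neg]; apply cos_PI2.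
    + apply centre_orthogonal.
  - intros t1 t2 H1 H2 Hne He. apply Hne.
    rewrite !Omega_centre, !omega_radius in He by easy.
    assert (Hs : p * sin t1 = p * sin t2).
    { apply (Dset_centre_inj p); [easy|apply Hw|apply Hw|]. intros z. apply He. }
    apply Rmult_eq_reg_l in Hs; [|lra].
    rewrite <- (asin_sin t1), <- (asin_sin t2) by easy. now rewrite Hs.
  - intros t Ht. rewrite Omega_centre, omega_radius by easy. apply CD_W; [lra|apply Hw2].
  - intros c r Hr. rewrite maximal_disk_in_expD by easy. split.
    + intros [w [Hwp He]].
      assert (Hb : -1 <= w / p <= 1).
      { split; apply Rmult_le_reg_r with p; try lra;
          unfold Rdiv; rewrite Rmult_assoc, Rinv_l; lra. }
      pose proof (asin_bound (w / p)) as Ht.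
      exists (asin (w / p)). split; [easy|].
      rewrite Omega_centre, omega_radius, sin_asin by easy.
      now replace (p * (w / p)) with w by (field; lra).
    + intros [t [Ht He]]. exists (p * sin t). split; [apply Hw|].
      now rewrite <- Omega_centre, <- omega_radius.
  - intros t Ht z. rewrite Omega_centre, omega_radius by easy.
    rewrite Dset_centre_boundary by (easy || apply Hw). rewrite sub_sqr_sin. split.
    + intros [x [Hx ->]].
      assert (Hx' : (x - p * cos t) * (x + p * cos t) = 0) by nra.
      apply Rmult_integral in Hx' as [Hx'|Hx']; [left|right]; do 2 f_equal; lra.
    + intros [->| ->]; eexists; (split; [|reflexivity]); ring.
Qed.
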